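(* Let $S$ be a numerical monoid with $\mathcal A (S) = \{n_1, \ldots, n_t\}$ where $t \in \mathbb N$, $1 < n_1 < \ldots < n_t$, and let $d = \gcd ( n_2-n_1, n_3-n_2, \ldots, n_t - n_{t-1} )$. Suppose that the Diophantine equations \[ (n_2-n_1) x_2 + \ldots + (n_t-n_1)x_t = dn_1 \quad \text{and} \quad (n_t-n_1)y_1 + \ldots + (n_t- n_{t-1})y_{t-1} = d n_t \] have solutions in the non-negative integers. Then there exists a $k^* \in \mathbb N$ such that $\mathcal V_k (S)$ is an arithmetical progression with difference $d$ for all $k \ge k^*$, and \[ \lim_{k \to \infty} \frac{|\mathcal V_k (S)|}{k} = \frac{1}{d} \Bigl( \frac{n_t}{n_1} - \frac{n_1}{n_t} \Bigr) . \]
   Context: $\mathbb N$ denotes the positive integers. A numerical monoid is a submonoid $S\subset(\mathbb N_0,+)$ with $\mathbb N\setminus S$ finite; $\mathcal A(S)$ is its set of atoms (its minimal generating set). For $k\in\mathbb N$, $\mathcal V_k(S)$ is the set of all $m\in\mathbb N$ for which there exist atoms $u_1,\dots,u_k,v_1,\dots,v_m\in\mathcal A(S)$ with $u_1+\dots+u_k=v_1+\dots+v_m$. A (finite, non-empty) set of integers is an arithmetical progression with difference $d$ if it has the form $\{y,y+d,\dots,y+ld\}$ with $y \in \mathbb Z$, $l\in\mathbb N_0$. *)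

(* Defs.v *)
From mathcomp Require Import all_boot all_order all_algebra finmap.
From mathcomp Require Import all_classical all_reals all_analysis.

Set Implicit Arguments.
Unset Strict Implicit.
Unset Printing Implicit Defensive.

Import Order.TTheory GRing.Theory Num.Theory.
Import numFieldNormedType.Exports.

Local Open Scope classical_set_scope.
Local Open Scope nat_scope.

(* As S contains 0, its complement in nat is the set of positive gaps. *)
Definition numerical_monoid (S : set nat) : Prop :=
  [/\ S 0,
      forall a b, S a -> S b -> S (a + b) &
      finite_set (~` S)].

(* 0 is the only unit of (S, +), so an atom is a nonzero element that is not a
   sum of two nonzero elements; these form the minimal generating set of S. *)
Definition atoms (S : set nat) : set nat :=
  [set a | [/\ S a, a <> 0 &
    forall b c, S b -> S c -> a = b + c -> b = 0 \/ c = 0]].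

(* V_k(S), the union of all sets of lengths containing k. *)
Definition V (S : set nat) (k : nat) : set nat :=
  [set m | 0 < m /\
    exists (u : 'I_k -> nat) (v : 'I_m -> nat),
      [/\ forall i, atoms S (u i),
          forall j, atoms S (v j) &
          \sum_(i < k) u i = \sum_(j < m) v j]].

Definition arith_progression (d : nat) (L : set int) : Prop :=
  exists (y : int) (l : nat),
    L = [set (y + (i * d)%N%:Z)%R | i in [set i : nat | i <= l]].

(* Main.v *)
(** Write [a = n_1], [b = n_t].  Since [gcd(d, a) = 1], a length [m] in [V_k]
    satisfies [m = k mod d], [m a <= k b] and [k a <= m b].  Conversely, if
    [m >= k] has the right residue and [k b - m a] is at least a constant, the
    first equation, which trades [X + d] atoms [a] for [X] atoms, yields an
    explicit equality of a sum of [k] atoms with a sum of [m] atoms; the case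
    [m <= k] is symmetric, as [m \in V_k] iff [k \in V_m].  Near the extremes
    of [V_k] all but boundedly many atoms on the side of [m] equal [a]
    (resp. [b]), so the first (resp. second) equation allows steps of [d] from
    the maximum (resp. minimum) of [V_k] into the interior.  Hence [V_k] is a
    progression whose ends are [k b / a] and [k a / b] up to constants. *)

Require Import Defs.
From mathcomp Require Import all_boot all_order all_algebra finmap.
From mathcomp Require Import all_classical all_reals all_analysis.
From mathcomp Require Import zify ring lra.

Import Order.TTheory GRing.Theory Num.Theory.
Import numFieldNormedType.Exports.

Local Open Scope classical_set_scope.
Local Open Scope nat_scope.

(** * Sums of a fixed number of elements of a set *)

Fixpoint kfold_sum (A : nat -> Prop) (k N : nat) : Prop :=
  if k is k'.+1 then exists x M, [/\ A x, kfold_sum A k' M & N = x + M]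
  else N = 0.

Lemma kfold_sumP A k N :
  kfold_sum A k N <->
  exists u : 'I_k -> nat, (forall i, A (u i)) /\ \sum_(i < k) u i = N.
Proof.
elim: k N => [|k IHk] N /=.
  split=> [->|[u [_ <-]]]; last by rewrite big_ord0.
  by exists (fun=> 0); rewrite big_ord0; split=> // -[].
split=> [[x [M [Ax /IHk[u [Au <-]] ->]]]|[u [Au <-]]].
  exists (fun i => if unlift ord0 i is Some j then u j else x).
  split=> [i|]; first by case: unliftP.
  rewrite big_ord_recl unlift_none; congr (_ + _).
  by apply: eq_bigr => i _; rewrite liftK.
exists (u ord0), (\sum_(i < k) u (lift ord0 i)).
split; rewrite ?big_ord_recl //.
by apply/IHk; exists (fun i => u (lift ord0 i)); split.
Qed.

Lemma kfold_sumD {A k l N M} :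
  kfold_sum A k N -> kfold_sum A l M -> kfold_sum A (k + l) (N + M).
Proof.
elim: k N => [|k IHk] N /= => [-> //|[x [P [Ax AP ->]]] AM].
by exists x, (P + M); split; rewrite ?addnA //; apply: IHk.
Qed.

Lemma kfold_sumM {A} j {k N} : kfold_sum A k N -> kfold_sum A (j * k) (j * N).
Proof.
by move=> AN; elim: j => [|j IHj] //; rewrite !mulSn; apply: kfold_sumD.
Qed.

Lemma kfold_sum1 {A x} : A x -> kfold_sum A 1 x.
Proof. by move=> Ax; exists x, 0; rewrite addn0. Qed.

Lemma kfold_sum_const {A} k {x} : A x -> kfold_sum A k (k * x).
Proof. by move=> /kfold_sum1/(kfold_sumM k); rewrite muln1. Qed.

Lemma kfold_sum_big {A} (s : seq nat) (n x : nat -> nat) :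
  (forall i, i \in s -> A (n i)) ->
  kfold_sum A (\sum_(i <- s) x i) (\sum_(i <- s) x i * n i).
Proof.
elim: s => [|i s IHs] As; first by rewrite !big_nil.
rewrite !big_cons; apply: kfold_sumD; first exact/kfold_sum_const/As/mem_head.
by apply: IHs => j js; apply: As; rewrite in_cons js orbT.
Qed.

Lemma kfold_sum_ge {A} a {k N} :
  (forall x, A x -> a <= x) -> kfold_sum A k N -> k * a <= N.
Proof.
move=> Aa; elim: k N => [//|k IHk] _ [x [M [/Aa ax /IHk kM ->]]].
by rewrite mulSn leq_add.
Qed.

Lemma kfold_sum_le {A} b {k N} :
  (forall x, A x -> x <= b) -> kfold_sum A k N -> N <= k * b.
Proof.
move=> Ab; elim: k N => [_ -> //|k IHk] _ [x [M [/Ab ax /IHk kM ->]]].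
by rewrite mulSn leq_add.
Qed.

Lemma kfold_sum_mod {A} d a {k N} :
  (forall x, A x -> x = a %[mod d]) -> kfold_sum A k N -> N = k * a %[mod d].
Proof.
move=> Aa; elim: k N => [_ -> //|k IHk] _ [x [M [/Aa ax /IHk kM ->]]].
by rewrite mulSn -modnDm ax kM modnDm.
Qed.

Lemma kfold_sum_split {A} c {k N} :
  kfold_sum A k N ->
  exists i l M, [/\ k = i + l, N = i * c + M &
                    kfold_sum (fun x => A x /\ x <> c) l M].
Proof.
elim: k N => [_ ->|k IHk _ [x [M [Ax /IHk[i [l [P [-> -> AP]]]] ->]]]].
  by exists 0, 0, 0.
have [->|/eqP xc] := eqVneq x c; first by exists i.+1, l, P; split=> //; lia.
by exists i, l.+1, (x + P); split; [lia | lia | exists x, P].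
Qed.

Lemma kfold_sum_weak {A} B {k N} :
  (forall x, A x -> B x) -> kfold_sum A k N -> kfold_sum B k N.
Proof.
by move=> AB; elim: k N => [|k IHk] N //= [x [M [/AB ? /IHk ? ->]]]; exists x, M.
Qed.

(** A summand other than [a] exceeds [a] by at least 1, so a sum within [C] of the minimum [k * a]
    has at most [C] such summands; at least [j] copies of [a] can be split off. *)
Lemma kfold_sum_low {A a C j k N} :
  A a -> (forall x, A x -> a <= x) -> kfold_sum A k N ->
  N <= k * a + C -> j + C <= k ->
  exists2 M, N = j * a + M & kfold_sum A (k - j) M.
Proof.
move=> Aa a_le /(kfold_sum_split a)[i [l [M [-> -> AM]]]] NC jk.
have lM : l * a.+1 <= M.
  apply: kfold_sum_ge AM => x [/a_le ax /eqP xa].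
  by rewrite ltn_neqAle eq_sym xa.
have [e ei] : exists e, i = j + e by exists (i - j); nia.
exists (e * a + M); first by rewrite ei mulnDl addnA.
have -> : i + l - j = e + l by lia.
apply: kfold_sumD (kfold_sum_const _ Aa) _.
by apply: kfold_sum_weak AM => x [].
Qed.

(** Mirror image: a summand other than [b] falls short of [b] by at least 1. *)
Lemma kfold_sum_high {A b C j k N} :
  A b -> (forall x, A x -> x <= b) -> kfold_sum A k N ->
  k * b <= N + C -> j + C <= k ->
  exists2 M, N = j * b + M & kfold_sum A (k - j) M.
Proof.
move=> Ab b_ge /(kfold_sum_split b)[i [l [M [-> -> AM]]]] NC jk.
have lM : l + M <= l * b.
  elim: l M AM {NC jk} => [_ -> //|l IHl _ [x [M [[/b_ge xb xnb] /IHl lM ->]]]].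
  by nia.
have [e ei] : exists e, i = j + e by exists (i - j); nia.
exists (e * b + M); first by rewrite ei mulnDl addnA.
have -> : i + l - j = e + l by lia.
apply: kfold_sumD (kfold_sum_const _ Ab) _.
by apply: kfold_sum_weak AM => x [].
Qed.

(** * Pairs of lengths of a common sum, and exchanges between them *)

Definition common_length (A : nat -> Prop) (k m : nat) : Prop :=
  exists2 N, kfold_sum A k N & kfold_sum A m N.

Lemma common_lengthC {A k m} : common_length A k m -> common_length A m k.
Proof. by case=> N; exists N. Qed.

Section Exchange.

Variables (A : nat -> Prop) (a b d X e : nat).
Hypotheses (Aa : A a) (Ab : A b).
Hypothesis A_bounds : forall x, A x -> a <= x <= b.
Hypothesis A_mod : forall x, A x -> x = a %[mod d].
Hypotheses (a_gt0 : 0 < a) (ab : a < b) (d_gt0 : 0 < d) (da : coprime d a).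
(** The two Diophantine equations in additive form: [X] is the sum of the [x_i], and [e + d] the sum
    of the [y_i]. *)
Hypothesis low_exchange : kfold_sum A X ((X + d) * a).
Hypothesis high_exchange : kfold_sum A (e + d) (e * b).

Let A_ge x : A x -> a <= x. Proof. by case/A_bounds/andP. Qed.
Let A_le x : A x -> x <= b. Proof. by case/A_bounds/andP. Qed.

Lemma common_length_le k m : common_length A k m -> k * a <= m * b.
Proof.
by case=> N /(kfold_sum_ge _ A_ge) kN /(kfold_sum_le _ A_le); apply: leq_trans.
Qed.

(** Both lengths times [a] are congruent to the common sum, and [a] is invertible modulo [d]. *)
Lemma common_length_mod k m : common_length A k m -> k = m %[mod d].
Proof.
case=> N /(kfold_sum_mod _ _ A_mod) kN /(kfold_sum_mod _ _ A_mod) mN.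
apply/eqP; have := etrans (esym kN) mN => /eqP.
wlog km : k m {N kN mN} / k <= m.
  move=> W; case: (leqP k m) => [/W//|/ltnW mk].
  by rewrite eq_sym => /(W _ _ mk); rewrite eq_sym.
rewrite eq_sym eqn_mod_dvd ?leq_mul2r ?km ?orbT // -mulnBl Gauss_dvdl //.
by rewrite -eqn_mod_dvd // eq_sym.
Qed.

(** In the sum of [k + d * j] atoms [a], [j] groups of [X + d] atoms are each traded for [X]
    atoms. *)
Lemma common_length_add_small k j : j * X <= k -> common_length A k (k + d * j).
Proof.
move=> jk; exists (j * ((X + d) * a) + (k - j * X) * a).
  have -> : k = j * X + (k - j * X) by lia.
  rewrite {2}subnKC //.
  by apply: kfold_sumD (kfold_sumM _ low_exchange) (kfold_sum_const _ Aa).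
rewrite mulnA -mulnDl.
have -> : j * (X + d) + (k - j * X) = k + d * j by nia.
exact: kfold_sum_const.
Qed.

(* Write [j + j' = (b - a) q] with [j' < b - a]; the [k] atoms [b] have the same
   sum as [j'] blocks from [low_exchange], [k - q d a] atoms [b] and as many
   atoms [a] as needed. *)
Lemma common_length_add_large k j :
  (b - a) * X <= d * j -> (k + d * j) * a + d * a * (b - a) <= k * b ->
  common_length A k (k + d * j).
Proof.
move=> Xj jk; exists (k * b); first exact: kfold_sum_const.
set c := b - a in Xj jk *; have c_gt0 : 0 < c by rewrite subn_gt0.
have bE : b = a + c by rewrite subnKC // ltnW.
have [q [j' [j'c jE]]] : exists q j', j' < c /\ j + j' = c * q.
  have := divn_eq j c; have := ltn_mod j c; rewrite c_gt0.
  case: (j %% c) (j %/ c) => [|r] p rc jE; first by exists p, 0; split; lia.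
  by exists p.+1, (c - r.+1); split; nia.
(* The slack [d * a * (b - a)] in the hypothesis absorbs the rounding [j' < c], so there are enough
   atoms [b] to remove. *)
have qk : q * (d * a) <= k.
  have : c * q * (d * a) <= c * k.
    have : (j + j') * (d * a) <= (j + c) * (d * a) by rewrite leq_mul2r; lia.
    by rewrite -jE; nia.
  by rewrite -mulnA leq_pmul2l.
(* By [(b - a) * X <= d * j], the number of atoms [a] to be filled in is non-negative. *)
have jw : j' * X + (k - q * (d * a)) <= k + d * j.
  have : j' * X <= c * X by rewrite leq_mul2r ltnW ?orbT.
  lia.
have -> : k * b = j' * ((X + d) * a) + (k - q * (d * a)) * b +
    (k + d * j - (j' * X + (k - q * (d * a)))) * a.
  have [r rE] : exists r, k = q * (d * a) + r by exists (k - q * (d * a)); lia.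
  rewrite rE addKn in jw *.
  have [w wE] : exists w, q * (d * a) + r + d * j = j' * X + r + w.
    by exists (q * (d * a) + r + d * j - (j' * X + r)); lia.
  rewrite wE addKn bE.
  have : (q * (d * a) + d * j) * a = (j' * X + w) * a by congr (_ * _); lia.
  have : (j + j') * (d * a) = c * q * (d * a) by rewrite jE.
  nia.
have -> : k + d * j = j' * X + (k - q * (d * a)) +
    (k + d * j - (j' * X + (k - q * (d * a)))) by lia.
rewrite addKn; apply: kfold_sumD (kfold_sum_const _ Aa).
by apply: kfold_sumD (kfold_sumM _ low_exchange) (kfold_sum_const _ Ab).
Qed.

Lemma common_length_interior k m :
  (b - a) * X * X <= k -> k <= m -> k = m %[mod d] ->
  m * a + d * a * (b - a) <= k * b -> common_length A k m.
Proof.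
move=> Xk km /eqP; rewrite eq_sym eqn_mod_dvd // => /dvdnP[j mkE].
have -> : m = k + d * j by lia.
move=> jk; have [Xj|Xj] := leqP ((b - a) * X) (d * j).
  exact: common_length_add_large.
(* Now [d * j < (b - a) * X], hence [j * X <= (b - a) * X * X <= k]. *)
apply: common_length_add_small; apply: leq_trans Xk.
by rewrite leq_mul2r; apply/orP; right; nia.
Qed.

(** The common sum is at most [k * b], hence within [C] of the least sum of [m] atoms. So [X + d] of
    these atoms can be taken equal to [a] and traded for [X] atoms. *)
Lemma common_length_sub C k m :
  common_length A k m -> k * b <= m * a + C -> X + d + C <= m ->
  common_length A k (m - d).
Proof.
move=> [N kN mN] km Cm; exists N => //.
have NC : N <= m * a + C by apply: leq_trans (kfold_sum_le _ A_le kN) km.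
have [M -> AM] := kfold_sum_low Aa A_ge mN NC Cm.
have -> : m - d = X + (m - (X + d)) by lia.
exact: kfold_sumD.
Qed.

Lemma common_length_add C k m :
  common_length A k m -> m * b <= k * a + C -> e + C <= m ->
  common_length A k (m + d).
Proof.
move=> [N kN mN] km Cm; exists N => //.
have NC : m * b <= N + C.
  by apply: leq_trans km _; rewrite leq_add2r; apply: kfold_sum_ge A_ge kN.
have [M -> AM] := kfold_sum_high Ab A_le mN NC Cm.
have -> : m + d = e + d + (m - e) by lia.
exact: kfold_sumD.
Qed.

(** [C] is the slack in [common_length_interior]. The bracket in [K] dominates all thresholds on
    lengths; its factor [b] passes them on to every length [m] shared with [k >= K], as
    [k <= k * a <= m * b]. *)
Let C := d * a * (b - a).
Let K := b * ((b - a) * X * X + X + d + C + e).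

Lemma common_length_convex k m1 m m2 :
  K <= k -> common_length A k m1 -> common_length A k m2 ->
  m1 <= m <= m2 -> k = m %[mod d] -> common_length A k m.
Proof.
move=> Kk km1 km2 /andP[m1m mm2] km.
have Kk' : (b - a) * X * X + X + d + C + e <= k.
  by apply: leq_trans Kk; rewrite leq_pmull // (leq_ltn_trans _ ab).
have [kLm|/ltnW mLk] := leqP k m.
  have [|Cm] := leqP (m * a + C) (k * b).
    by apply: common_length_interior => //; lia.
  (* Here [m], and so every length from [m] to [m2], is within the slack of the upper bound: descend
     from [m2] in steps of [d]. *)
  have [i m2E] : exists i, m2 = m + i * d.
    have : m2 == m %[mod d] by rewrite -km (common_length_mod _ _ km2).
    by rewrite eqn_mod_dvd // => /dvdnP[i ?]; exists i; lia.
  rewrite {}m2E in km2 mm2; elim: i {mm2} km2 => [|i IHi]; first by rewrite addn0.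
  move=> /(common_length_sub C); rewrite mulSn addnCA addKn => H.
  by apply/IHi/H; nia.
have mK : (b - a) * X * X + X + d + C + e <= m.
  have := common_length_le _ _ km1 => km1a.
  have : b * ((b - a) * X * X + X + d + C + e) <= b * m.
    by apply: leq_trans Kk _; nia.
  by rewrite leq_pmul2l // (leq_ltn_trans _ ab).
have [kC|Ck] := leqP (k * a + C) (m * b).
  by apply: common_lengthC; apply: common_length_interior => //; lia.
(* Symmetrically, [m] is within the slack of the lower bound: ascend from [m1]. *)
have [i mE] : exists i, m = m1 + i * d.
  have : m == m1 %[mod d] by rewrite -km (common_length_mod _ _ km1).
  by rewrite eqn_mod_dvd // => /dvdnP[i ?]; exists i; lia.
have m1K : X + d + C + e <= m1.
  have := common_length_le _ _ km1 => km1a.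
  have : b * ((b - a) * X * X + X + d + C + e) <= b * m1.
    by apply: leq_trans Kk _; nia.
  by rewrite leq_pmul2l ?(leq_ltn_trans _ ab) //; lia.
rewrite {}mE {m1m mm2 km mLk mK} in Ck *.
elim: i Ck => [|i IHi]; rewrite ?addn0 // => iC.
have -> : m1 + i.+1 * d = m1 + i * d + d by lia.
by apply: (common_length_add C); [apply: IHi; nia | nia | lia].
Qed.

Lemma common_length_near_max k :
  K <= k -> exists2 m, common_length A k m & k * b <= m * a + (C + d * a).
Proof.
move=> Kk; have Kk' : (b - a) * X * X + C <= k.
  apply: leq_trans Kk; apply: (@leq_trans ((b - a) * X * X + X + d + C + e)).
    by lia.
  by rewrite leq_pmull // (leq_ltn_trans _ ab).
(* [common_length_interior] reaches [k + d * j] when [j * (d * a) <= r]; the largest such [j] leaves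
   a remainder below [d * a]. *)
set r := k * (b - a) - C.
have Cr : C <= k * (b - a) by nia.
have := divn_eq r (d * a); have := ltn_mod r (d * a).
rewrite muln_gt0 d_gt0 a_gt0; set j := r %/ _ => /= rm rE.
have kb : k * b = k * a + k * (b - a) by rewrite -mulnDr subnKC // ltnW.
exists (k + d * j); last by nia.
by apply: common_length_interior; rewrite ?leq_addr ?[k + _]addnC ?[d * j]mulnC ?modnMDl //; [lia | nia].
Qed.

Lemma common_length_near_min k :
  K <= k -> exists2 m, common_length A k m & m * b <= k * a + (C + d * b).
Proof.
move=> Kk; have b_gt0 : 0 < b by apply: leq_ltn_trans ab.
have Kk' : (b - a) * X * X + C <= k.
  apply: leq_trans Kk; apply: (@leq_trans ((b - a) * X * X + X + d + C + e)).
    by lia.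
  by rewrite leq_pmull.
(* With the roles of the two lengths swapped, [k - d * j] is reached when [j * (d * b) <= r]. *)
set r := k * (b - a) - C.
have Cr : C <= k * (b - a) by nia.
have := divn_eq r (d * b); have := ltn_mod r (d * b).
rewrite muln_gt0 d_gt0 b_gt0; set j := r %/ _ => /= rm rE.
have kb : k * b = k * a + k * (b - a) by rewrite -mulnDr subnKC // ltnW.
have jk : d * j <= k.
  have : b * (d * j) <= b * k by nia.
  by rewrite leq_pmul2l.
have [m mE] : exists m, k = m + d * j by exists (k - d * j); lia.
have mb : m * b = k * b - d * j * b by rewrite mE mulnDl addnK.
exists m; last by nia.
apply: common_lengthC; apply: common_length_interior; rewrite ?mE ?leq_addr //.
- have : b * ((b - a) * X * X) <= b * m by nia.
  by rewrite leq_pmul2l.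
- by rewrite addnC mulnC modnMDl.
- by rewrite -mE; nia.
Qed.

(** For the minimum [y] and maximum [z], the number of steps is [l = (z - y) / d]. The estimates
    compare it with [k * (b / a - a / b) / d], multiplied by [a * b * d] to stay in [nat]. *)
Lemma common_length_progression k :
  0 < k -> K <= k -> exists y l, [/\
    forall m, common_length A k m <-> exists2 i, i <= l & m = y + i * d,
    a * b * d * l <= k * (b ^ 2 - a ^ 2) &
    k * (b ^ 2 - a ^ 2) <= a * b * d * l + (b * (C + d * a) + a * (C + d * b))].
Proof.
move=> k_gt0 Kk.
pose P := [pred m | `[< common_length A k m >]].
have b_gt0 : 0 < b by apply: leq_ltn_trans ab.
have Pk : exists m, P m.
  by exists k; apply/asboolP; exists (k * a); apply: kfold_sum_const.
have Pub m : P m -> m <= k * b.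
  by move=> /asboolP/common_lengthC/common_length_le; nia.
case: (ex_minnP Pk) => y /asboolP ky y_min.
case: (ex_maxnP Pk Pub) => z /asboolP kz z_max.
have yz : y <= z by apply: z_max; apply/asboolP.
have [l zE] : exists l, z = y + l * d.
  have : z == y %[mod d].
    by rewrite -(common_length_mod _ _ ky) (common_length_mod _ _ kz).
  by rewrite eqn_mod_dvd // => /dvdnP[l ?]; exists l; lia.
have abl : a * b * d * l = b * (z * a) - a * (y * b).
  by rewrite zE; have -> : b * ((y + l * d) * a) = a * (y * b) + a * b * d * l
    by [nia]; rewrite addKn.
have kab : k * (b ^ 2 - a ^ 2) = b * (k * b) - a * (k * a).
  by rewrite mulnBr -!mulnn; congr (_ - _); nia.
have za := common_length_le _ _ (common_lengthC kz).
have yb := common_length_le _ _ ky.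
have bza : b * (z * a) <= b * (k * b) by rewrite leq_mul2l za orbT.
have ayb : a * (k * a) <= a * (y * b) by rewrite leq_mul2l yb orbT.
exists y, l; split; last 2 first.
- by rewrite abl kab leq_sub.
- have [m km mC] := common_length_near_max _ Kk.
  have [m' km' mC'] := common_length_near_min _ Kk.
  have mz : m <= z by apply: z_max; apply/asboolP.
  have ym : y <= m' by apply: y_min; apply/asboolP.
  have : b * (k * b) <= b * (z * a + (C + d * a)).
    by rewrite leq_mul2l (leq_trans mC) ?orbT // leq_add2r leq_mul2r mz orbT.
  have : a * (y * b) <= a * (k * a + (C + d * b)).
    by rewrite leq_mul2l (leq_trans _ mC') ?orbT // leq_mul2r ym orbT.
  rewrite abl kab !(mulnDr b) !(mulnDr a); lia.
move=> m; split=> [km|[i il ->]].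
  have ym : y <= m by apply: y_min; apply/asboolP.
  have mz : m <= z by apply: z_max; apply/asboolP.
  have : m == y %[mod d].
    by rewrite -(common_length_mod _ _ ky) (common_length_mod _ _ km).
  rewrite eqn_mod_dvd // => /dvdnP[i iE]; exists i; last by lia.
  by rewrite -(leq_pmul2r d_gt0); lia.
apply: (common_length_convex k y _ z) => //; first by rewrite zE; nia.
by rewrite addnC modnMDl; apply: common_length_mod.
Qed.

End Exchange.

(** * Numerical monoids, gcds and limits *)

Lemma V_common_length (S : set nat) (k m : nat) :
  V S k m <-> 0 < m /\ common_length (atoms S) k m.
Proof.
split=> [[m_gt0 [u [v [Au Av uv]]]]|[m_gt0 [N]]].
  split=> //; exists (\sum_(i < k) u i); apply/kfold_sumP; first by exists u.
  by exists v; rewrite uv.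
move=> /kfold_sumP[u [Au <-]] /kfold_sumP[v [Av vu]]; split=> //.
by exists u, v.
Qed.

(** Divisibility by [g] passes from the atoms to all of [S] by strong induction, and the cofinite
    set [S] contains two consecutive integers. *)
Lemma numerical_monoid_gcd_atoms (S : set nat) (g : nat) :
  numerical_monoid S -> (forall x, atoms S x -> g %| x) -> g = 1.
Proof.
move=> [S0 _ /finite_seqP[s sE]] gA.
have gS x : S x -> g %| x.
  have [N] := ubnP x; elim: N x => // N IHN x xN Sx.
  have [/gA //|xA] := pselect (atoms S x).
  have [->|/eqP x0] := eqVneq x 0; first exact: dvdn0.
  have [[y [z [Sy Sz xE [y0 z0]]]]|noyz] := pselect (exists y z,
      [/\ S y, S z, x = y + z & y <> 0 /\ z <> 0]).
    by rewrite xE dvdn_add // IHN //; lia.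
  exfalso; apply: xA; split=> // y z Sy Sz xE.
  have [->|/eqP y0] := eqVneq y 0; first by left.
  have [->|/eqP z0] := eqVneq z 0; first by right.
  by case: noyz; exists y, z.
pose N := (\max_(x <- s) x).+1.
have SN x : N <= x -> S x.
  move=> Nx; apply: contrapT => nSx.
  have : [set` s] x by rewrite -sE.
  by move=> /= xs; have := @leq_bigmax_seq _ s xpredT id x xs isT; lia.
apply/eqP; rewrite -dvdn1 -(dvdn_addr 1 (gS N (SN N (leqnn N)))) addn1.
exact/gS/SN/leqnSn.
Qed.

Lemma dvdn_biggcd (s : seq nat) (F : nat -> nat) (i : nat) :
  i \in s -> \big[gcdn/0]_(j <- s) F j %| F i.
Proof. by move=> /(big_rem i) -> //=; apply: dvdn_gcdl. Qed.

(** Multiplied by [p * k], the distance to the limit is at most [M], which is below [eps * p * k]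
    once [k] reaches [M / (p * eps)]. *)
Lemma cvg_linear_ratio (R : realType) (f : nat -> nat) (p q M K : nat) :
  0 < p ->
  (forall k, K <= k -> p * f k <= k * q + M /\ k * q <= p * f k + M) ->
  ((f k)%:R / k%:R : R)%R @[k --> \oo] --> (q%:R / p%:R : R)%R.
Proof.
move=> p_gt0 fK; apply/cvgrPdist_le => /= eps eps_gt0.
have p0 : (0 < p%:R :> R)%R by rewrite ltr0n.
near=> k.
have k_gt0 : 0 < k by near: k; exists 1.
have k0 : (0 < k%:R :> R)%R by rewrite ltr0n.
have [|+ +] := fK k; first by near: k; exists K.
rewrite -!(ler_nat R) !natrD !natrM => fle fge.
have Mk : (M%:R / (p%:R * eps) <= k%:R)%R by near: k; apply: nbhs_infty_ger.
rewrite ler_pdivrMr ?mulr_gt0 // in Mk.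
rewrite -(ler_pM2r (mulr_gt0 p0 k0)) -{1}(gtr0_norm (mulr_gt0 p0 k0)) -normrM.
have -> : ((q%:R / p%:R - (f k)%:R / k%:R) * (p%:R * k%:R) =
    k%:R * q%:R - p%:R * (f k)%:R :> R)%R by field; rewrite !gt_eqF.
rewrite ler_norml; nra.
Unshelve. all: by end_near. Qed.

Local Open Scope ring_scope.

Theorem theorem6p6 (R : realType) (S : set nat) (t : nat) (n : nat -> nat)
    (d : nat)
    (hS : numerical_monoid S)
    (ht : (0 < t)%N)
    (hA : atoms S = [set n i | i in [set i : nat | (1 <= i <= t)%N]])
    (hn1 : (1 < n 1%N)%N)
    (hn : forall i : nat, (1 <= i < t)%N -> (n i < n i.+1)%N)
    (hd : d = \big[gcdn/0%N]_(1 <= i < t) (n i.+1 - n i)%N)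
    (hx : exists x : nat -> nat,
        (\sum_(2 <= i < t.+1) (n i - n 1) * x i = d * n 1)%N)
    (hy : exists y : nat -> nat,
        (\sum_(1 <= i < t) (n t - n i) * y i = d * n t)%N) :
  (exists kstar : nat, (0 < kstar)%N /\
     forall k : nat, (kstar <= k)%N ->
       arith_progression d [set m%:Z | m in V S k]) /\
  (#|` fset_set (V S k)|%:R / k%:R : R) @[k --> \oo] -->
    (d%:R^-1 * ((n t)%:R / (n 1%N)%:R - (n 1%N)%:R / (n t)%:R) : R).
Proof.

(* Verification of the exchange hypotheses for the atoms, then transfer to [V S k] *)
set a := n 1%N; set b := n t.
have n_atom i : (1 <= i <= t)%N -> atoms S (n i) by rewrite hA => it; exists i.
have n_le i j : (1 <= i <= j)%N -> (j <= t)%N -> (n i <= n j)%N.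
  move=> /andP[i1 ij]; elim: j ij => [|j IHj]; first by lia.
  rewrite leq_eqVlt => /predU1P[<- //|ij] jt.
  by apply: (leq_trans (IHj ij (ltnW jt))); apply/ltnW/hn; lia.
have A_bounds x : atoms S x -> (a <= x <= b)%N.
  by rewrite hA => -[i /= it <-]; rewrite !n_le //; lia.
have n_mod i : (1 <= i <= t)%N -> n i = a %[mod d].
  elim: i => // -[//|i] IHi it; rewrite -IHi; last by lia.
  apply/eqP; rewrite eqn_mod_dvd; last by apply/ltnW/hn; lia.
  by rewrite hd (dvdn_biggcd _ (fun i => n i.+1 - n i)%N) // mem_index_iota; lia.
have A_mod x : atoms S x -> x = a %[mod d].
  by rewrite hA => -[i /= it <-]; apply: n_mod.
have Aa : atoms S a by apply: n_atom; lia.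
have Ab : atoms S b by apply: n_atom; lia.
(* All atoms are congruent to [a] modulo [d], so [gcdn d a] divides each of them. *)
have da : coprime d a.
  rewrite /coprime (numerical_monoid_gcd_atoms _ (gcdn d a) hS) // => x /A_mod xa.
  rewrite /dvdn -(modn_dvdm x (dvdn_gcdl d a)) xa (modn_dvdm a (dvdn_gcdl d a)).
  exact: dvdn_gcdr.
(* For [t = 1] the empty gcd is 0, and coprimality of 0 and [a] would force [a = 1]. *)
have t_gt1 : (1 < t)%N.
  rewrite ltn_neqAle ht andbT; apply/eqP => t1; move: da.
  by rewrite hd -t1 big_geq // /coprime gcd0n => /eqP a1; move: hn1; rewrite -/a a1.
have ab : (a < b)%N by apply: (leq_trans (hn 1%N _)); [lia | apply: n_le; lia].
have d_gt0 : (0 < d)%N.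
  rewrite lt0n; apply: contraTneq da => ->; rewrite /coprime gcd0n.
  by apply/eqP => a1; move: hn1; rewrite -/a a1.
have a_gt0 : (0 < a)%N by apply: ltnW.
have [x xE] := hx; have [y yE] := hy.
set X := (\sum_(2 <= i < t.+1) x i)%N; set Y := (\sum_(1 <= i < t) y i)%N.
have lowX : kfold_sum (atoms S) X ((X + d) * a)%N.
  (* This is the first equation with [X * n 1] added to both sides. *)
  suff -> : ((X + d) * a = \sum_(2 <= i < t.+1) x i * n i)%N.
    by apply: kfold_sum_big => i; rewrite mem_index_iota => it; apply: n_atom; lia.
  rewrite mulnDl -xE big_distrl -big_split /=; apply: eq_big_nat => i it.
  rewrite -/a -[in RHS](subnK (_ : a <= n i)%N); last by apply: n_le; lia.
  by rewrite mulnDr addnC [(_ * x i)%N]mulnC.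
have YE : (Y * b = \sum_(1 <= i < t) y i * n i + d * b)%N.
  rewrite -yE big_distrl -big_split /=; apply: eq_big_nat => i it.
  rewrite -/b -{1}[b](subnKC (_ : n i <= b)%N); last by apply: n_le; lia.
  by rewrite mulnDr [((_ - _) * y i)%N]mulnC.
(* This keeps the subtraction in [e = Y - d] from truncating. *)
have dY : (d <= Y)%N.
  by rewrite -(leq_pmul2r (ltn_trans a_gt0 ab)) YE leq_addl.
have highY : kfold_sum (atoms S) (Y - d + d)%N ((Y - d) * b)%N.
  rewrite subnK // mulnBl YE addnK.
  by apply: kfold_sum_big => i; rewrite mem_index_iota => it; apply: n_atom; lia.
have prog := common_length_progression _ _ _ _ _ _ Aa Ab A_bounds A_mod a_gt0 ab
  d_gt0 da lowX highY.
move: prog; set K := (b * _)%N; set M := (_ * _ + a * _)%N => prog.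
have {prog} VP k : (0 < k)%N -> (K <= k)%N -> exists z l, [/\
    V S k = [set z + i * d | i in [set i | i <= l]]%N,
    (a * b * d * l <= k * (b ^ 2 - a ^ 2))%N &
    (k * (b ^ 2 - a ^ 2) <= a * b * d * l + M)%N].
  move=> k_gt0 Kk; have [z [l [zl lo hi]]] := prog k k_gt0 Kk.
  exists z, l; split=> //; apply/seteqP; split=> m.
    by move=> /V_common_length[_ /zl[i il ->]]; exists i.
  case=> i /= il <-; apply/V_common_length.
  have L : common_length (atoms S) k (z + i * d)%N by apply/zl; exists i.
  (* The length is positive: length 0 would give [k * a <= 0]. *)
  split=> //; have := common_length_le _ _ _ A_bounds _ _ L.
  by case: (z + i * d)%N => //; rewrite mul0n leqn0 muln_eq0; lia.
split.
  exists K.+1; split=> // k Kk; have [||z [l [-> _ _]]] := VP k; [lia | lia |].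
  exists z%:Z, l; apply/seteqP; split=> m /=.
    by move=> [_ [i il <-] <-]; exists i; rewrite ?PoszD.
  by move=> [i il <-]; exists (z + i * d)%N; rewrite ?PoszD //; exists i.
have -> : d%:R^-1 * (b%:R / a%:R - a%:R / b%:R) =
    (b ^ 2 - a ^ 2)%N%:R / (a * b * d)%N%:R :> R.
  have a0 : a%:R != 0 :> R by rewrite pnatr_eq0 -lt0n.
  have b0 : b%:R != 0 :> R by rewrite pnatr_eq0 -lt0n (ltn_trans a_gt0 ab).
  have d0 : d%:R != 0 :> R by rewrite pnatr_eq0 -lt0n.
  rewrite natrB ?leq_exp2r ?(ltnW ab) // !natrX !natrM.
  move: a%:R b%:R d%:R a0 b0 d0 => u v w u0 v0 w0.
  by field; rewrite u0 v0 w0.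
(* The progression has [l.+1] elements; the extra one accounts for the term [a * b * d] in the
   error. *)
apply: (@cvg_linear_ratio _ _ _ _ (M + a * b * d) K.+1) => [|k Kk].
  by rewrite !muln_gt0 a_gt0 (ltn_trans a_gt0 ab).
have [||z [l [-> lo hi]]] := VP k; [lia | lia |].
rewrite (@card_fset_set _ _ l.+1); first by rewrite mulnS; lia.
have -> : [set i | i <= l]%N = `I_l.+1 by apply/seteqP; split=> i /=; rewrite ltnS.
by apply: inj_card_eq => i j _ _ /addnI/eqP; rewrite eqn_pmul2r // => /eqP.
Qed.
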